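(* Let $G$ be a periodic Abelian group. A subset $X\subseteq G$ is midconvex if and only if for every $x\in X$ the set $X-x$ is a subgroup of $G$ such that every element of the quotient group $G/(X-x)$ has odd order.
   Context: Abelian groups are written additively. A subset $X$ of an Abelian group $G$ is called midconvex if for every $x,y\in X$ the set $\frac{x+y}{2} := \{z\in G : 2z = x+y\}$ is a subset of $X$. A group $G$ is periodic if for every $g\in G$ there exists a positive integer $n$ such that $ng=0$. For $x\in G$, $X-x := \{a-x : a\in X\}$. The order of an element $g$ is the smallest positive integer $n$ such that $ng=0$. *)

(* Defs.v *)
From HB Require Import structures.
From mathcomp Require Import all_boot all_order all_algebra.
From mathcomp Require Import boolp classical_sets.

Set Implicit Arguments.
Unset Strict Implicit.
Unset Printing Implicit Defensive.

Import GRing.Theory.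
Local Open Scope classical_set_scope.
Local Open Scope ring_scope.

(* The set (x + y)/2; it may be empty or have several elements, since
   doubling need be neither surjective nor injective. *)
Definition midpoints (G : zmodType) (x y : G) : set G :=
  [set z | z *+ 2 = x + y].

Definition midconvex (G : zmodType) (X : set G) : Prop :=
  forall x y : G, X x -> X y -> midpoints x y `<=` X.

Definition periodic (G : zmodType) : Prop :=
  forall g : G, exists n : nat, (0 < n)%N /\ g *+ n = 0.

Definition translate (G : zmodType) (X : set G) (x : G) : set G :=
  [set a - x | a in X].

(* The library's order #[g] covers finite groups only. *)
Definition has_order (G : zmodType) (g : G) (n : nat) : Prop :=
  [/\ (0 < n)%N, g *+ n = 0
    & forall m : nat, (0 < m)%N -> g *+ m = 0 -> (n <= m)%N].

Definition has_odd_order (G : zmodType) (g : G) : Prop :=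
  exists n : nat, has_order g n /\ odd n.

(* Main.v *)
Require Import Defs.
From HB Require Import structures.
From mathcomp Require Import all_boot all_order all_algebra.
From mathcomp Require Import cyclic.
From mathcomp Require Import boolp classical_sets.
Import GRing.Theory.
Local Open Scope classical_set_scope.
Local Open Scope ring_scope.

(** Midconvexity is invariant under translation, so everything reduces to
    midconvex sets [Y] containing [0]; for these, [2 z \in Y] implies
    [z \in Y], the element [z] being a midpoint of [2 z] and [0].

    Two facts make [Y] a subgroup.  First, [Y] is stable under adding an
    element [t] of 2-power order: [y + t] is a midpoint of [y] and [y + 2 t],
    and doubling lowers the order of [t] ([midconvex_add_pow2_torsion]).
    Second, let [s = a + b] with [a, b \in Y], and write an annihilator of [s]
    as [2 ^ k * m] with [m] odd.  Euler's theorem gives [e > 0] with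
    [2 ^ e = 1] modulo [m], hence [t = 2 ^ e s - s] is killed by [2 ^ k].  Thus
    [2 ^ e s = a + (b + t)] is a sum of two elements of [Y], its half
    [2 ^ (e - 1) s] is in [Y], and [e - 1] further halvings towards [0] lead to
    [s] itself ([midconvex_addr]).  Opposites are multiples in a periodic
    group.

    The first fact also shows that [Y] contains all elements of 2-power order;
    as [m g] has 2-power order when [2 ^ k * m] kills [g], the class of [g]
    modulo [Y] is killed by the odd number [m].

    Conversely, if [H] is a subgroup and [G / H] has only elements of odd order,
    then [G / H] has no 2-torsion, so [2 z \in H] implies [z \in H]
    ([odd_quotient_halving]); with [H = X - x] and a midpoint [z] of [x] and
    [y], this applies to [2 (z - x) = y - x]. *)

Lemma has_order_dvdn (G : zmodType) (g : G) (n m : nat) :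
  has_order g n -> g *+ m = 0 -> (n %| m)%N.
Proof.
case=> n0 gn nmin gm.
have gr : g *+ (m %% n) = 0.
  by move: gm; rewrite {1}(divn_eq m n) mulrnDr mulnC mulrnA gn mul0rn add0r.
rewrite /dvdn -leqn0 leqNgt; apply/negP => r0.
by have := nmin _ r0 gr; rewrite leqNgt ltn_pmod.
Qed.

Lemma has_order_exists (G : zmodType) (g : G) (m : nat) :
  (0 < m)%N -> g *+ m = 0 -> exists n, has_order g n.
Proof.
move=> m0 gm.
have ex : exists n, (0 < n)%N && (g *+ n == 0).
  by exists m; rewrite m0 gm eqxx.
case: (ex_minnP ex) => n /andP[n0 /eqP gn] nmin.
exists n; split=> // p p0 gp.
by apply: nmin; rewrite p0 gp eqxx.
Qed.

Lemma has_odd_order_annihilator (G : zmodType) (g : G) (m : nat) :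
  odd m -> g *+ m = 0 -> has_odd_order g.
Proof.
move=> om gm.
have [n gn] := has_order_exists G g m (odd_gt0 om) gm.
by exists n; split=> //; apply: dvdn_odd om; apply: has_order_dvdn gn gm.
Qed.

Lemma odd_order_no_2torsion (G : zmodType) (g : G) :
  has_odd_order g -> g *+ 2 = 0 -> g = 0.
Proof.
move=> [n [[_ gn _] on]] g2.
by move: gn; rewrite -(odd_double_half n) on mulrnDr -mul2n mulrnA g2 mul0rn
  addr0.
Qed.

Lemma periodic_pow2_odd_annihilator (G : zmodType) (g : G) :
  periodic G -> exists k m : nat, odd m /\ g *+ (2 ^ k * m) = 0.
Proof.
move=> /(_ g)[n [n0 gn]].
have [m] := pfactor_coprime (isT : prime 2) n0.
rewrite coprime2n => om nE.
by exists (logn 2 n), m; split=> //; rewrite mulnC -nE.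
Qed.

Lemma pi_quot_eq0 (G : zmodType) (H : zmodClosed G) (g : G) :
  (\pi_(Quotient.quot H) g = 0)%qT <-> g \in H.
Proof.
have -> : 0 = (\pi_(Quotient.quot H) 0)%qT by rewrite raddf0.
rewrite -{2}[g]subr0 Quotient.idealrBE.
by split=> [->|/eqP].
Qed.

Lemma odd_quotient_halving (G : zmodType) (H : zmodClosed G) (g : G) :
  (forall q : Quotient.quot H, has_odd_order q) ->
  g *+ 2 \in H -> g \in H.
Proof.
move=> oddH /pi_quot_eq0; rewrite raddfMn => g2.
by apply/pi_quot_eq0; apply: odd_order_no_2torsion g2.
Qed.

Lemma translateE (G : zmodType) (X : set G) (x a : G) :
  translate X x a <-> X (a + x).
Proof.
split=> [[b Xb <-]|Xax]; first by rewrite subrK.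
by exists (a + x); rewrite ?addrK.
Qed.

Lemma midconvex_translate (G : zmodType) (X : set G) (x : G) :
  midconvex X -> midconvex (translate X x).
Proof.
move=> Xmid a b /translateE Xa /translateE Xb z z2; apply/translateE.
by apply: Xmid Xa Xb _ _; rewrite /midpoints /= mulrnDl z2 mulr2n addrACA.
Qed.

Lemma midconvex_halving (G : zmodType) (Y : set G) (z : G) (k : nat) :
  midconvex Y -> Y 0 -> Y (z *+ (2 ^ k)) -> Y z.
Proof.
move=> Ymid Y0; elim: k => [|k IHk]; first by rewrite expn0 mulr1n.
rewrite expnS mulnC mulrnA => Yz; apply: IHk.
by apply: Ymid Yz Y0 _ _; rewrite /midpoints /= addr0.
Qed.

(** [y + t] is a midpoint of [y] and [y + 2 t], and [2 t] is killed by a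
    smaller power of [2]. *)
Lemma midconvex_add_pow2_torsion (G : zmodType) (Y : set G) (y t : G) (k : nat) :
  midconvex Y -> Y y -> t *+ (2 ^ k) = 0 -> Y (y + t).
Proof.
move=> Ymid Yy; elim: k t => [|k IHk] t.
  by rewrite expn0 mulr1n => ->; rewrite addr0.
rewrite expnS mulrnA => /IHk Yt.
by apply: Ymid Yy Yt _ _; rewrite /midpoints /= mulrnDl [y *+ 2]mulr2n -addrA.
Qed.

(** By Euler's theorem, multiplication by some [2 ^ e] with [e > 0] is the
    identity up to 2-power torsion on a given element: doubling is invertible
    on the odd part of the cyclic group that this element generates. *)
Lemma periodic_pow2_fixed (G : zmodType) (s : G) :
  periodic G ->
  exists e k : nat, (s *+ (2 ^ e.+1) - s) *+ (2 ^ k) = 0.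
Proof.
move=> /(periodic_pow2_odd_annihilator G s)[k [m [om sn]]].
exists (totient m).-1, k.
rewrite prednK ?totient_gt0 ?odd_gt0 //.
have /eqP : 2 ^ totient m = 1 %[mod m].
  by apply: Euler_exp_totient; rewrite coprime2n.
rewrite eqn_mod_dvd ?expn_gt0 // => /dvdnP[c cE].
rewrite -{2}[s]mulr1n -mulrnBr ?expn_gt0 // cE -mulrnA.
by rewrite -mulnA [(m * _)%N]mulnC mulnC mulrnA sn mul0rn.
Qed.

(** With [s = a + b] and [t = 2 ^ e.+1 s - s] of 2-power order, [2 ^ e s] is a
    midpoint of [a] and [b + t], and [s] is reached from it by halving. *)
Lemma midconvex_addr (G : zmodType) (Y : set G) (a b : G) :
  periodic G -> midconvex Y -> Y 0 -> Y a -> Y b -> Y (a + b).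
Proof.
move=> hG Ymid Y0 Ya Yb.
have [e [k tk]] := periodic_pow2_fixed G (a + b) hG.
apply: (midconvex_halving G Y _ e Ymid Y0).
have Ybt := midconvex_add_pow2_torsion G Y b _ k Ymid Yb tk.
apply: Ymid Ya Ybt _ _; rewrite /midpoints /= -mulrnA -expnSr.
by rewrite addrA addrC subrK.
Qed.

Lemma midconvex_mulrn (G : zmodType) (Y : set G) (a : G) (n : nat) :
  periodic G -> midconvex Y -> Y 0 -> Y a -> Y (a *+ n).
Proof.
move=> hG Ymid Y0 Ya; elim: n => [//|n IHn].
by rewrite mulrS; apply: midconvex_addr.
Qed.

Lemma midconvex_oppr (G : zmodType) (Y : set G) (a : G) :
  periodic G -> midconvex Y -> Y 0 -> Y a -> Y (- a).
Proof.
move=> hG Ymid Y0 Ya; have [n [n0 an]] := hG a.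
have -> : - a = a *+ n.-1.
  by apply/esym/eqP; rewrite -addr_eq0 -mulrSr prednK // an.
exact: midconvex_mulrn.
Qed.

Lemma midconvex_zmodClosed (G : zmodType) (Y : set G) :
  periodic G -> midconvex Y -> Y 0 ->
  exists H : zmodClosed G, Y = [set` H].
Proof.
move=> hG Ymid Y0; pose P : {pred G} := fun g => `[< Y g >].
have Pclosed : zmod_closed P.
  split=> [|a b]; first exact/asboolP.
  move=> /asboolP Ya /asboolP Yb; apply/asboolP.
  by apply: midconvex_addr => //; apply: midconvex_oppr.
pose PC := GRing.isZmodClosed.Build G P Pclosed.
pose H : zmodClosed G := HB.pack P PC.
exists H; apply/seteqP; split=> g /=.
  by move=> Yg; apply/asboolP.
by move=> /asboolP.
Qed.

(** If [2 ^ k * m] kills [g], then [m g] has 2-power order, hence lies in [H],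
    so the odd number [m] kills the class of [g]. *)
Lemma midconvex_quotient_odd (G : zmodType) (H : zmodClosed G) :
  periodic G -> midconvex [set` H] ->
  forall q : Quotient.quot H, has_odd_order q.
Proof.
move=> hG Hmid; elim/quotW => g.
have [k [m [om gn]]] := periodic_pow2_odd_annihilator G g hG.
apply: (has_odd_order_annihilator _ _ m om).
rewrite -raddfMn; apply/pi_quot_eq0; rewrite -[g *+ m]add0r.
apply: (midconvex_add_pow2_torsion G [set` H] 0 (g *+ m) k Hmid) => /=.
  exact: rpred0.
by rewrite -mulrnA mulnC.
Qed.

Theorem theorem3 (G : zmodType) (hG : periodic G) (X : set G) :
  midconvex X <->
  (forall x : G, X x ->
     exists H : zmodClosed G,
       translate X x = [set` H] /\
       (forall q : Quotient.quot H, has_odd_order q)).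
Proof.
split=> [Xmid x Xx|Xsub x y Xx Xy z z2].
  have Ymid := midconvex_translate G X x Xmid.
  have Y0 : translate X x 0 by apply/translateE; rewrite add0r.
  have [H YH] := midconvex_zmodClosed G (translate X x) hG Ymid Y0.
  by exists H; split=> //; apply: midconvex_quotient_odd; rewrite -?YH.
have [H [XH oddH]] := Xsub x Xx.
have XHE a : X (a + x) <-> a \in H.
  by rewrite -translateE XH.
rewrite -[z](subrK x); apply/XHE; apply: odd_quotient_halving => //.
apply/XHE; rewrite mulrnBl z2 mulr2n.
by rewrite opprD addrA addrAC subrK [x + y]addrC addrK.
Qed.
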